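(* For every positive integer $k$ there exists a constant $C = C_k$ such that the following holds. Let $T$ be a tournament on $n$ vertices and $(X,Y)$ a partition of its vertex set such that $\overrightarrow{e}(X,Y)\geq C n^{2- 1/ \lceil k/2 \rceil}$. Then there exists a sequence $(x_1, \ldots, x_k, y_1, \ldots, y_k) \in X^k \times Y^k$ of distinct vertices which is the $k$-th power of a path.
   Context: A tournament is an orientation of a complete graph. $\overrightarrow{e}(X,Y)$ is the number of edges of $T$ oriented from $X$ to $Y$. A sequence of vertices $(u_1,\ldots,u_l)$ is the $k$-th power of a path if $u_iu_j$ is an edge of $T$ for all $i<j\le i+k$. *)

(* Defs.v *)
From mathcomp Require Import all_boot.

Set Implicit Arguments.
Unset Strict Implicit.
Unset Printing Implicit Defensive.

(* [e u v] means that the edge between u and v is oriented from u to v. *)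
Definition tournament (V : finType) (e : rel V) : Prop :=
  irreflexive e /\ forall u v : V, u != v -> e u v (+) e v u.

Definition edges_from_to (V : finType) (e : rel V) (X Y : {set V}) : nat :=
  #|[set p : V * V | [&& p.1 \in X, p.2 \in Y & e p.1 p.2]]|.

Definition path_power (V : finType) (e : rel V) (k l : nat)
    (u : l.-tuple V) : Prop :=
  forall i j : 'I_l, i < j <= i + k -> e (tnth u i) (tnth u j).

(* Main.v *)
Require Import Defs.
From mathcomp Require Import all_boot all_order all_algebra zify ring.
From mathcomp Require Import reals exp.
Import Order.TTheory GRing.Theory Num.Theory.

Set Implicit Arguments.
Unset Strict Implicit.
Unset Printing Implicit Defensive.

(** Let r = ceil(k/2) and m = k - r <= r. It suffices to find transitive r-tuples
    s in X and t in Y with every edge between them going from s to t, a transitive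
    m-tuple in the common in-neighbourhood of t that precedes s, and a transitive
    m-tuple in the common out-neighbourhood of s that follows t.

    By convexity there are at least C n^r complete pairs (s, t). A positive
    proportion of the r-tuples of a large tournament is transitive, so, up to
    O(n^r), a positive proportion of the complete pairs has s and t transitive.
    Given t and all but the first vertex of s, the candidates for that vertex form
    a set W, each in-neighbour within W of the chosen candidate precedes all of s,
    and only boundedly many vertices of W have bounded in-degree in W. Hence the
    pairs in which s cannot be extended number at most a constant times the
    complete pairs with one vertex of s removed, which is a small proportion of
    all complete pairs when C is large. The same holds for t.

    To make the two sides symmetric, t is listed backwards and Y carries the
    reversed tournament. *)

(** * Tournament and tuple preliminaries, and a power-mean inequality *)

Lemma tournament_flip (A : finType) (e : rel A) :
  tournament e -> tournament (fun u v => e v u).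
Proof.
by case=> irr tot; split=> [u|u v neq_uv]; [exact: irr | rewrite addbC tot].
Qed.

Lemma pairwise_rev_flip (T : Type) (e : rel T) (s : seq T) :
  pairwise e (rev s) = pairwise (fun u v => e v u) s.
Proof.
elim: s => //= x s IHs; rewrite rev_cons -cats1 pairwise_cat IHs /= andbT.
by rewrite allrel1r all_rev.
Qed.

Lemma tournament_pairwise_uniq (A : finType) (e : rel A) (s : seq A) :
  tournament e -> pairwise e s -> uniq s.
Proof.
case=> irr _; rewrite uniq_pairwise; apply: sub_pairwise => x y exy.
by apply: contraTneq exy => ->; rewrite irr.
Qed.

Lemma sum_tupleS (A : finType) (r : nat) (F : r.+1.-tuple A -> nat) :
  \sum_s F s = \sum_x \sum_(s : r.-tuple A) F [tuple of x :: s].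
Proof.
rewrite pair_big /=.
rewrite (reindex (fun p : A * r.-tuple A => [tuple of p.1 :: p.2])) //=.
exists (fun s : r.+1.-tuple A => (thead s, [tuple of behead s])).
- by case=> x s _; congr (_, _); apply: val_inj.
- by move=> s _; rewrite [RHS]tuple_eta; apply: val_inj.
Qed.

Lemma sum_mem_card (A : finType) (W : pred A) : \sum_x (W x : nat) = #|W|.
Proof. by rewrite -sum1_card [RHS]big_mkcond. Qed.

Lemma card_tuple_all (A : finType) (r : nat) (W : pred A) :
  \sum_(s : r.-tuple A) (all W s : nat) = #|W| ^ r.
Proof.
elim: r => [|r IHr].
  rewrite (bigD1 [tuple]) //= big1 // => s.
  by case/eqP; exact: tuple0.
rewrite sum_tupleS expnS -IHr -sum_mem_card big_distrl /=.
apply: eq_bigr => x _; rewrite big_distrr /=.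
by apply: eq_bigr => s _; rewrite -mulnb.
Qed.

Lemma leq_expn2r (r m n : nat) : m <= n -> m ^ r <= n ^ r.
Proof. by case: r => [|r] le_mn; rewrite ?expn0 ?leq_exp2r. Qed.

Lemma leq_sum_exp (I : finType) (a : I -> nat) (r : nat) :
  (\sum_i a i) ^ r.+1 <= #|I| ^ r * \sum_i a i ^ r.+1.
Proof.
(* Chebyshev's sum inequality, from [a_i a_j^r + a_j a_i^r <= a_i^(r+1) + a_j^(r+1)]. *)
have chebyshev m : (\sum_i a i) * (\sum_i a i ^ m) <= #|I| * \sum_i a i ^ m.+1.
  suff: 2 * ((\sum_i a i) * (\sum_i a i ^ m)) <= 2 * (#|I| * \sum_i a i ^ m.+1).
    by rewrite leq_pmul2l.
  have dbl : #|I| * \sum_i a i ^ m.+1 = \sum_i \sum_(j : I) a i ^ m.+1.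
    by rewrite big_distrr /=; apply: eq_bigr => i _; rewrite sum_nat_const.
  have -> : 2 * (#|I| * \sum_i a i ^ m.+1)
      = \sum_i \sum_j (a i ^ m.+1 + a j ^ m.+1).
    rewrite mul2n -addnn {1}dbl dbl {2}exchange_big -big_split /=.
    by apply: eq_bigr => i _; rewrite big_split.
  have -> : 2 * ((\sum_i a i) * \sum_i a i ^ m)
      = \sum_i \sum_j (a i * a j ^ m + a j * a i ^ m).
    have prd : (\sum_i a i) * (\sum_i a i ^ m) = \sum_i \sum_j a i * a j ^ m.
      by rewrite big_distrl /=; apply: eq_bigr => i _; rewrite big_distrr.
    rewrite mul2n -addnn {1}prd prd {2}exchange_big -big_split /=.
    by apply: eq_bigr => i _; rewrite big_split.
  apply: leq_sum => i _; apply: leq_sum => j _; rewrite !expnS.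
  have [le_ij|/ltnW le_ji] := leqP (a i) (a j).
    have: a i ^ m <= a j ^ m by apply: leq_expn2r.
    by nia.
  have: a j ^ m <= a i ^ m by apply: leq_expn2r.
  by nia.
elim: r => [|r IHr]; first by rewrite !expn1 expn0 mul1n.
rewrite expnS (leq_trans (leq_mul (leqnn _) IHr)) // mulnCA expnSr -mulnA.
by rewrite leq_mul2l chebyshev orbT.
Qed.

(** * Degrees and transitive tuples in a tournament *)

(** Double counting inside the set [L] of low vertices: it spans [#|L| * (#|L| - 1) / 2] edges,
    while each of its vertices receives at most [q - 1] of them. *)
Lemma card_low_indegree (A : finType) (e : rel A) (W : {set A}) (q : nat) :
  tournament e -> #|[set x in W | #|[set z in W | e z x]| < q]| <= q.*2.
Proof.
case=> irr tot; set L := [set x in W | _].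
have [->|/set0Pn[x0 Lx0]] := eqVneq L set0; first by rewrite cards0.
have sumL : \sum_(x in L) \sum_(z in L) (e z x : nat) <= #|L| * q.-1.
  rewrite -sum_nat_const; apply: leq_sum => x /setIdP[_ lt_q].
  apply: leq_trans (_ : #|[set z in W | e z x]| <= _); last first.
    by rewrite -ltnS (ltn_predK lt_q).
  rewrite -big_mkcondr sum1_card; apply: subset_leq_card; apply/subsetP => z.
  by case/andP=> /setIdP[Wz _] ezx; rewrite inE Wz.
have: \sum_(x in L) \sum_(z in L) (e z x + e x z) = #|L| * #|L|.-1.
  rewrite -sum_nat_const; apply: eq_bigr => x Lx.
  rewrite (bigD1 x) //= irr add0n (cardsD1 x L) Lx /= -sum1_card.
  apply: eq_big => z; first by rewrite !inE andbC.
  by case/andP=> _ /tot; case: (e z x) (e x z) => [] [].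
under eq_bigr do rewrite big_split.
rewrite big_split /= [X in _ + X]exchange_big /= addnn => eqL.
have L_gt0 : 0 < #|L| by apply/card_gt0P; exists x0.
have: #|L| * #|L|.-1 <= #|L| * q.-1.*2 by rewrite -eqL -doubleMr leq_double.
have q_gt0 : 0 < q by case/setIdP: Lx0 => _; apply: leq_trans.
by rewrite leq_pmul2l // => le; lia.
Qed.

(** Induction on [r]: at least an eighth of [W] has out-degree at least [#|W| / 8] in [W], and each
    such vertex can precede every transitive [r]-tuple of its out-neighbourhood. *)
Lemma transitive_tuple_count (A : finType) (e : rel A) (r : nat) (W : {set A}) :
  tournament e -> 8 ^ r <= #|W| ->
  #|W| ^ r <= 8 ^ (r ^ 2) *
    \sum_(s : r.-tuple A) (all (mem W) s && pairwise e s : nat).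
Proof.
move=> e_tour; elim: r W => [|r IHr] W leW.
  by rewrite !expn0 mul1n (bigD1 [tuple]).
(* [q] is [#|W| / 8] rounded up. *)
pose q := (#|W| + 7) %/ 8; pose out x := [set z in W | e x z].
pose L := [set x in W | #|out x| < q].
have leL : #|L| <= q.*2 by exact: (card_low_indegree W q (tournament_flip e_tour)).
have leW8 : 8 <= #|W| by rewrite (leq_trans _ leW) // expnS leq_pmulr // expn_gt0.
have leD : #|W| <= 8 * #|W :\: L|.
  rewrite cardsD; have := subset_leq_card (subsetIr W L); rewrite /q in leL; lia.
have leq_term x : x \in W :\: L ->
    #|W| ^ r <= 8 ^ (r ^ 2 + r) *
      \sum_(s : r.-tuple A) (all (mem (out x)) s && pairwise e s : nat).
  rewrite !inE => /andP[+ Wx]; rewrite Wx /= -leqNgt => le_out.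
  have leW8out : #|W| <= 8 * #|out x| by rewrite /q in le_out; lia.
  apply: leq_trans (leq_expn2r r leW8out) _.
  rewrite expnMn addnC expnD -mulnA leq_mul2l IHr ?orbT //.
  by rewrite -(leq_pmul2l (isT : 0 < 8)) -expnS (leq_trans leW).
rewrite sum_tupleS expnS; apply: leq_trans (leq_mul leD (leqnn _)) _.
rewrite -mulnA -sum_nat_const.
have le_exp : 8 * 8 ^ (r ^ 2 + r) <= 8 ^ (r.+1 ^ 2).
  by rewrite -expnS leq_exp2l //; lia.
apply: leq_trans (leq_mul le_exp (leqnn _)); rewrite -mulnA leq_mul2l /=.
rewrite big_distrr [leqRHS](bigID (mem (W :\: L))) /=; apply: leq_trans (leq_addr _ _).
apply: leq_sum => x DLx; apply: leq_trans (leq_term x DLx) _.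
rewrite leq_mul2l; apply/orP; right; apply: leq_sum => s _ /=.
have -> : x \in W by case/setDP: DLx.
case all_out: (all _ s) => //=; have /andP[-> ->] // : all (mem W) s && all (e x) s.
rewrite -all_predI; apply: sub_all all_out => z /=; by rewrite inE.
Qed.

(** * Counting complete pairs of tuples *)

Definition common_nbrs (A B : finType) (g : A -> B -> bool) (t : seq B) : {set A} :=
  [set x | all (g x) t].

(** Entries may repeat, which makes the count a sum of exact powers of codegrees. *)
Definition complete_pairs (A B : finType) (g : A -> B -> bool) (a b : nat) : nat :=
  \sum_(s : a.-tuple A) \sum_(t : b.-tuple B) (allrel g s t : nat).

Lemma allrel_common_nbrs (A B : finType) (g : A -> B -> bool) (s : seq A) (t : seq B) :
  allrel g s t = all (mem (common_nbrs g t)) s.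
Proof. by apply: eq_all => x; rewrite /= inE. Qed.

Lemma complete_pairsE (A B : finType) (g : A -> B -> bool) (a b : nat) :
  complete_pairs g a b = \sum_(t : b.-tuple B) #|common_nbrs g t| ^ a.
Proof.
rewrite /complete_pairs exchange_big; apply: eq_bigr => t _.
rewrite -[RHS](card_tuple_all a); apply: eq_bigr => s _.
by rewrite allrel_common_nbrs.
Qed.

Lemma complete_pairs_flip (A B : finType) (g : A -> B -> bool) (a b : nat) :
  complete_pairs (fun y x => g x y) b a = complete_pairs g a b.
Proof.
rewrite /complete_pairs exchange_big; apply: eq_bigr => s _.
by apply: eq_bigr => t _; rewrite allrelC.
Qed.

(* The Kővári–Sós–Turán count: convexity is applied once to the degrees of the
   vertices of [A] and once to the codegrees of the tuples of [B]. *)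
Lemma complete_pairs_lower (A B : finType) (g : A -> B -> bool) (p n : nat) :
  #|A| <= n -> #|B| <= n ->
  (\sum_x \sum_y (g x y : nat)) ^ (p.+1 * p.+1) <=
    n ^ (2 * (p.+1 * p)) * complete_pairs g p.+1 p.+1.
Proof.
move=> leA leB.
have codeg : \sum_(t : p.+1.-tuple B) #|common_nbrs g t|
    = \sum_x (\sum_y (g x y : nat)) ^ p.+1.
  under [RHS]eq_bigr do rewrite sum_mem_card -card_tuple_all.
  rewrite exchange_big; apply: eq_bigr => t _; rewrite sum_mem_card.
  by apply: eq_card => x; rewrite inE.
have le1 := leq_sum_exp (fun x => \sum_y (g x y : nat)) p.
have le2 := leq_sum_exp (fun t : p.+1.-tuple B => #|common_nbrs g t|) p.
rewrite -complete_pairsE codeg card_tuple in le2.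
rewrite expnM; apply: leq_trans (leq_expn2r p.+1 le1) _; rewrite expnMn.
apply: leq_trans (leq_mul (leqnn _) le2) _; rewrite mulnA leq_mul2r.
apply/orP; right; rewrite mul2n -addnn expnD leq_mul // -expnM.
  by rewrite mulnC leq_expn2r.
by rewrite leq_expn2r.
Qed.

(** The additive term covers small [W], so that the bound can be summed over all common
    neighbourhoods. *)
Lemma transitive_tuple_count_add (A : finType) (e : rel A) (r : nat) (W : {set A}) :
  tournament e ->
  #|W| ^ r <= 8 ^ (r ^ 2) *
    \sum_(s : r.-tuple A) (all (mem W) s && pairwise e s : nat) + (8 ^ r) ^ r.
Proof.
move=> e_tour; have [le_W|/ltnW lt_W] := leqP (8 ^ r) #|W|.
  exact: leq_trans (transitive_tuple_count e_tour le_W) (leq_addr _ _).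
exact: leq_trans (leq_expn2r r lt_W) (leq_addl _ _).
Qed.

Lemma complete_pairs_transitive (A B : finType) (eA : rel A) (eB : rel B)
    (g : A -> B -> bool) (r n : nat) :
  tournament eA -> tournament eB -> #|A| <= n -> #|B| <= n ->
  complete_pairs g r r <= 8 ^ (r ^ 2) * (8 ^ (r ^ 2) *
    (\sum_(s : r.-tuple A) \sum_(t : r.-tuple B)
      ([&& allrel g s t, pairwise eA s & pairwise eB t] : nat))
    + (n * 8 ^ r) ^ r) + (n * 8 ^ r) ^ r.
Proof.
move=> eA_tour eB_tour leA leB; rewrite !expnMn.
(* First [s] is made transitive for each fixed [t], then [t] for each fixed transitive [s]. *)
apply: (@leq_trans (8 ^ (r ^ 2) * (\sum_(s : r.-tuple A) \sum_(t : r.-tuple B)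
    (allrel g s t && pairwise eA s : nat)) + #|B| ^ r * (8 ^ r) ^ r)).
  rewrite complete_pairsE exchange_big /= -[#|B| ^ r]card_tuple -sum_nat_const.
  rewrite big_distrr -big_split /=; apply: leq_sum => t _.
  apply: leq_trans (transitive_tuple_count_add _ _ eA_tour) _.
  rewrite leq_add2r leq_mul2l; apply/orP; right; apply: leq_sum => s _.
  by rewrite allrel_common_nbrs.
apply: leq_add; last by rewrite leq_mul2r leq_expn2r ?orbT.
rewrite leq_mul2l; apply/orP; right.
apply: (@leq_trans (8 ^ (r ^ 2) * (\sum_(s : r.-tuple A) \sum_(t : r.-tuple B)
    ([&& allrel g s t, pairwise eA s & pairwise eB t] : nat))
    + #|A| ^ r * (8 ^ r) ^ r)); last first.
  by rewrite leq_add2l leq_mul2r leq_expn2r ?orbT.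
rewrite -[#|A| ^ r]card_tuple -sum_nat_const big_distrr -big_split /=.
apply: leq_sum => s _.
case pw_s: (pairwise eA s); last by rewrite big1 // => t _; rewrite andbF.
under eq_bigr do rewrite andbT allrelC allrel_common_nbrs.
under [X in _ <= _ * X + _]eq_bigr do rewrite /= allrelC allrel_common_nbrs.
rewrite (@card_tuple_all _ r (mem (common_nbrs (fun y x => g x y) s))).
exact: transitive_tuple_count_add.
Qed.

(** * Extending a transitive complete pair *)

Definition extenders (A B : finType) (e : rel A) (g : A -> B -> bool)
    (s : seq A) (t : seq B) : {set A} :=
  [set z in common_nbrs g t | all (e z) s].

(* For a fixed tail of [s] and a fixed [t], the admissible heads form a set [W]
   and the extenders of [s] are the in-neighbours of its head in [W]; only a
   bounded number of vertices of [W] have few in-neighbours there. *)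
Lemma few_extenders_count (A B : finType) (e : rel A) (g : A -> B -> bool)
    (p b q : nat) :
  tournament e ->
  \sum_(s : p.+1.-tuple A) \sum_(t : b.-tuple B)
    ([&& allrel g s t, pairwise e s & #|extenders e g s t| < q] : nat)
  <= q.*2 * complete_pairs g p b.
Proof.
move=> e_tour; rewrite sum_tupleS exchange_big /complete_pairs big_distrr /=.
apply: leq_sum => s _; rewrite exchange_big big_distrr /=; apply: leq_sum => t _.
pose W := [set x in common_nbrs g t | all (e x) s].
have [gst|ngst] := boolP (allrel g s t); last first.
  by rewrite big1 // => x _; rewrite allrel_consl (negPf ngst) andbF.
pose L := [set x in W | #|[set z in W | e z x]| < q].
rewrite muln1; apply: leq_trans (card_low_indegree W q e_tour); rewrite -/L.
have <- := sum_mem_card (mem L).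
apply: leq_sum => x _; rewrite allrel_consl gst andbT /=.
case gx: (all (g x) t) => //=; case ex: (all (e x) s) => //=.
case: (pairwise e s) => //=; rewrite !inE gx ex /=.
have -> : extenders e g (x :: s) t = [set z in W | e z x].
  by apply/setP => z; rewrite !inE /= -andbA [all _ s && _]andbC.
by [].
Qed.

(** For a codegree [c], [d * c ^ p] is at most [c ^ p.+1] if [d <= c], and at most [d ^ p.+1]
    otherwise. *)
Lemma complete_pairs_pred (A B : finType) (g : A -> B -> bool) (p b d : nat) :
  d * complete_pairs g p b <= complete_pairs g p.+1 b + #|B| ^ b * d ^ p.+1.
Proof.
rewrite !complete_pairsE -card_tuple -sum_nat_const big_distrr -big_split /=.
apply: leq_sum => t _; set c := #|_|.
have [le_dc|/ltnW le_cd] := leqP d c.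
  by rewrite expnS (leq_trans _ (leq_addr _ _)) // leq_mul2r le_dc orbT.
by rewrite (expnS d) (leq_trans _ (leq_addl _ _)) // leq_mul2l leq_expn2r ?orbT.
Qed.

Lemma transitive_tuple_exists (A : finType) (e : rel A) (m : nat) (W : {set A}) :
  tournament e -> 8 ^ m <= #|W| ->
  exists2 a : m.-tuple A, all (mem W) a & pairwise e a.
Proof.
move=> e_tour leW; have := transitive_tuple_count e_tour leW.
have [/existsP[a /andP[aW pw_a]]|] :=
  boolP [exists a : m.-tuple A, all (mem W) a && pairwise e a]; first by exists a.
rewrite negb_exists => /forallP none; rewrite big1 => [|a _]; last first.
  by rewrite (negPf (none a)).
by rewrite muln0 leqNgt expn_gt0 (leq_trans _ leW) ?expn_gt0.
Qed.

Lemma extension_exists (A B : finType) (e : rel A) (g : A -> B -> bool)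
    (m : nat) (s : seq A) (t : seq B) :
  tournament e -> pairwise e s -> 8 ^ m <= #|extenders e g s t| ->
  exists2 a : m.-tuple A, pairwise e (a ++ s) & allrel g a t.
Proof.
move=> e_tour pw_s /(transitive_tuple_exists e_tour)[a aE pw_a].
exists a.
  rewrite pairwise_cat pw_a pw_s !andbT; apply: sub_all aE => z.
  by rewrite /= inE => /andP[].
by rewrite allrel_common_nbrs; apply: sub_all aE => z; rewrite /= inE => /andP[].
Qed.

(** The first summand is the error of [complete_pairs_pred] for the [D] chosen in
    [extendable_pair_exists]; the second gathers the errors of making both tuples transitive. *)
Definition pair_threshold (p m : nat) : nat :=
  let c := 8 ^ (p.+1 ^ 2) in
  (8 * 8 ^ m * c ^ 2) ^ p.+1 + 2 * ((8 ^ p.+1) ^ p.+1 * c.+1).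

(** The factor [8 * q * c ^ 2] turns the second hypothesis into [2 * c ^ 2 * P2 <= P0 + N * DR];
    after doubling the first, one [P0] cancels. *)
Lemma double_counting_arith (c q P0 P2 N M DR : nat) :
  0 < q -> P0 <= c * (c * P2 + N * M) + N * M ->
  8 * q * c ^ 2 * P2 <= q.*2 * ((P0 + N * DR) * 2) ->
  P0 <= (DR + 2 * (M * c.+1)) * N.
Proof.
move=> q_gt0 le_P0; have -> : 8 * q * c ^ 2 * P2 = 4 * q * (2 * (c * (c * P2))).
  by rewrite -mulnn; ring.
have -> : q.*2 * ((P0 + N * DR) * 2) = 4 * q * (P0 + N * DR).
  by rewrite -muln2; ring.
rewrite leq_pmul2l ?muln_gt0 //; rewrite mulnDr in le_P0.
have -> : (DR + 2 * (M * c.+1)) * N = N * DR + 2 * (c * (N * M)) + 2 * (N * M).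
  by rewrite -addn1; ring.
by lia.
Qed.

Lemma extendable_pair_exists (A B : finType) (eA : rel A) (eB : rel B)
    (g : A -> B -> bool) (p m n : nat) :
  tournament eA -> tournament eB -> #|A| <= n -> #|B| <= n ->
  pair_threshold p m * n ^ p.+1 < complete_pairs g p.+1 p.+1 ->
  exists (s : p.+1.-tuple A) (t : p.+1.-tuple B) (a : m.-tuple A) (b : m.-tuple B),
    [/\ pairwise eA (a ++ s), pairwise eB (b ++ t)
      & allrel g (a ++ s) t && allrel g s (b ++ t)].
Proof.
move=> eA_tour eB_tour leA leB; set r := p.+1; set P0 := complete_pairs g r r.
move=> lt_P0; set q := 8 ^ m; set c := 8 ^ (r ^ 2).
pose gop (y : B) (x : A) := g x y.
have le_trans := complete_pairs_transitive g r eA_tour eB_tour leA leB.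
have badA := few_extenders_count g p r q eA_tour.
have badB := few_extenders_count gop p r q eB_tour.
set D := 8 * q * c ^ 2.
have subA : D * complete_pairs g p r <= P0 + n ^ r * D ^ r.
  apply: leq_trans (complete_pairs_pred _ _ _ _) _.
  by rewrite leq_add2l leq_mul2r leq_expn2r ?orbT.
have subB : D * complete_pairs gop p r <= P0 + n ^ r * D ^ r.
  apply: leq_trans (complete_pairs_pred _ _ _ _) _.
  by rewrite complete_pairs_flip leq_add2l leq_mul2r leq_expn2r ?orbT.
rewrite exchange_big /= in badB.
rewrite expnMn in le_trans; move: le_trans badA badB.
set P2 := \sum_(s : r.-tuple A) _; set bA := \sum_(s : r.-tuple A) _.
set bB := \sum_(s : r.-tuple A) _ => le_trans badA badB.
(* Pairs short of extenders on some side cannot exhaust the transitive complete pairs, or [P0] would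
   fall below the threshold. *)
have lt_bad : bA + bB < P2.
  have q_gt0 : 0 < q by rewrite expn_gt0.
  rewrite ltnNge; apply/negP => le_P2; move: lt_P0; rewrite ltnNge => /negP; apply.
  have leD : D * P2 <= q.*2 * ((P0 + n ^ r * D ^ r) * 2).
    apply: leq_trans (leq_mul (leqnn _) (leq_trans le_P2 (leq_add badA badB))) _.
    rewrite -mulnDr mulnCA leq_mul2l; apply/orP; right.
    by rewrite mulnDr muln2 -addnn; apply: leq_add.
  exact: double_counting_arith q_gt0 le_trans leD.
have [/existsP[s /existsP[t]]|] := boolP [exists s : r.-tuple A, exists t : r.-tuple B,
    [&& allrel g s t, pairwise eA s, pairwise eB t, q <= #|extenders eA g s t|
      & q <= #|extenders eB gop t s|]].
  case/and5P=> gst pw_s pw_t extA extB.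
  have [a pw_as gat] := extension_exists eA_tour pw_s extA.
  have [b pw_bt gbs] := extension_exists eB_tour pw_t extB.
  exists s, t, a, b; split=> //.
  by rewrite allrel_catl allrel_catr gst gat allrelC gbs.
(* Without an extendable pair, each pair counted by [P2] is counted by [bA] or [bB]. *)
rewrite negb_exists => /forallP none; move: lt_bad; rewrite ltnNge => /negP[].
rewrite -big_split; apply: leq_sum => s _; rewrite -big_split; apply: leq_sum => t _ /=.
have /existsPn/(_ t) := none s; rewrite [allrel gop _ _]allrelC 2!(leqNgt q).
by case: (allrel g s t); case: (pairwise eA s); case: (pairwise eB t);
  case: (#|extenders eA g s t| < q); case: (#|extenders eB gop t s| < q).
Qed.

(** * Assembling the power of a path *)

(** Only edges from [a] to [b] are not provided, and none is required: there [i < m <= r <= j - k],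
    so [j > i + k]. *)
Lemma path_power_cat (V : finType) (e : rel V) (k m r : nat) (x y : k.-tuple V)
    (a s t b : seq V) :
  size a = m -> size t = r -> m <= r ->
  val x = a ++ s -> val y = t ++ b ->
  pairwise e (a ++ s) -> pairwise e (t ++ b) ->
  allrel e (a ++ s) t -> allrel e s (t ++ b) ->
  path_power e k (cat_tuple x y).
Proof.
move=> size_a size_t le_mr x_def y_def pw_x pw_y e_xt e_sy i j /andP[lt_ij le_jik].
set x0 := tnth (cat_tuple x y) i; rewrite /x0 !(tnth_nth x0) /=.
have := ltn_ord j; have := ltn_ord i; rewrite -x_def in pw_x; rewrite -y_def in pw_y.
rewrite !nth_cat !size_tuple => lt_i lt_j.
have [lt_jk|le_kj] := ltnP j k.
  rewrite (ltn_trans lt_ij lt_jk); apply: (pairwiseP x0 pw_x) => //;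
  by rewrite unfold_in /= size_tuple // (ltn_trans lt_ij).
have [lt_ik|le_ki] := ltnP i k; last first.
  by apply: (pairwiseP x0 pw_y); rewrite ?unfold_in /= ?size_tuple; lia.
have lt_jk : j - k < k by lia.
have y_in : nth x0 y (j - k) \in t ++ b by rewrite -y_def mem_nth ?size_tuple.
have x_in : nth x0 x i \in a ++ s by rewrite -x_def mem_nth ?size_tuple.
have [lt_im|le_mi] := ltnP i m.
  apply: (allrelP e_xt) => //; rewrite y_def nth_cat size_t.
  have lt_jr : j - k < r by lia.
  by rewrite lt_jr mem_nth ?size_t.
apply: (allrelP e_sy) => //; rewrite x_def nth_cat size_a ltnNge le_mi /= mem_nth //.
by have := size_tuple x; rewrite x_def size_cat size_a => size_x; rewrite ltn_subLR // size_x.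
Qed.

Lemma power_path_of_many_edges (V : finType) (e : rel V) (X Y : {set V})
    (k p m : nat) :
  k = m + p.+1 -> m <= p.+1 -> tournament e -> [disjoint X & Y] -> 0 < #|V| ->
  pair_threshold p m * #|V| ^ (2 * (p.+1 * p) + p.+1) <
    edges_from_to e X Y ^ (p.+1 * p.+1) ->
  exists x y : k.-tuple V,
    [/\ {subset x <= X}, {subset y <= Y}, uniq (x ++ y)
      & path_power e k (cat_tuple x y)].
Proof.
move=> k_def le_mp e_tour XY V_gt0 lt_edges.
(* Membership is built into [g], so completeness to the nonempty tuples [t] and [s] puts the
   vertices in [X] and [Y]. *)
pose g u v := [&& u \in X, v \in Y & e u v].
have edgesE : edges_from_to e X Y = \sum_u \sum_v (g u v : nat).
  by rewrite pair_big /= sum_mem_card /edges_from_to cardsE.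
have lt_pairs : pair_threshold p m * #|V| ^ p.+1 < complete_pairs g p.+1 p.+1.
  have pow_gt0 : 0 < #|V| ^ (2 * (p.+1 * p)) by rewrite expn_gt0 V_gt0.
  rewrite -(ltn_pmul2l pow_gt0) mulnCA -expnD (leq_trans lt_edges) // edgesE.
  exact: complete_pairs_lower.
have [s [t [a [b [pw_as pw_bt /andP[g_ast g_sbt]]]]]] :=
  extendable_pair_exists e_tour (tournament_flip e_tour) (leqnn _) (leqnn _) lt_pairs.
have size_x : size (a ++ s) == k by rewrite size_cat !size_tuple k_def.
have size_y : size (rev t ++ rev b) == k.
  by rewrite size_cat !size_rev !size_tuple k_def addnC.
have s0 : thead s \in s := mem_tnth _ _.
have t0 : thead t \in t := mem_tnth _ _.
have pw_y : pairwise e (rev t ++ rev b) by rewrite -rev_cat pairwise_rev_flip.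
have subX u : u \in a ++ s -> u \in X.
  by move=> u_in; have /and3P[] := allrelP g_ast u (thead t) u_in t0.
have subY v : v \in rev t ++ rev b -> v \in Y.
  rewrite -rev_cat mem_rev => v_in.
  by have /and3P[] := allrelP g_sbt (thead s) v s0 v_in.
have g_e (u v : V) : g u v -> e u v by case/and3P.
exists (Tuple size_x), (Tuple size_y); split=> //=.
  rewrite cat_uniq (tournament_pairwise_uniq e_tour pw_as).
  rewrite (tournament_pairwise_uniq e_tour pw_y) andbT /=.
  apply/hasPn => v /subY Yv; apply/negP => /subX Xv.
  by have /pred0P/(_ v) := XY; rewrite /= Xv Yv.
apply: (@path_power_cat _ _ _ m p.+1 _ _ a s (rev t) (rev b)) => //.
- by rewrite size_tuple.
- by rewrite size_rev size_tuple.
- by rewrite allrel_revr (sub_allrel g_e).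
- by rewrite -rev_cat allrel_revr (sub_allrel g_e).
Qed.

(** * From real to integer exponents *)

Local Open Scope ring_scope.

Theorem theorem4p1 (R : realType) (k : nat) (k_gt0 : (0 < k)%N) :
  exists C : R,
    forall (V : finType) (e : rel V) (X Y : {set V}),
      (0 < #|V|)%N ->
      tournament e ->
      X :|: Y = [set: V] ->
      [disjoint X & Y] ->
      C * (#|V|%:R `^ (2 - (uphalf k)%:R^-1)) <= (edges_from_to e X Y)%:R ->
      exists (x y : k.-tuple V),
        [/\ {subset x <= X}, {subset y <= Y}, uniq (x ++ y)
          & path_power e k (cat_tuple x y)].
Proof.
have [p r_def] : exists p, uphalf k = p.+1 by exists (uphalf k).-1; lia.
pose m := (k - p.+1)%N; pose E := pair_threshold p m.
(* The successor makes the edge bound strict: [E < E.+1 ^ r]. *)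
exists (E.+1%:R) => V e X Y V_gt0 e_tour _ XY; rewrite r_def => le_edges.
apply: (@power_path_of_many_edges V e X Y k p m) => //; rewrite /m; try lia.
rewrite -/m -(ltr_nat R) natrX; set r := (p.+1 * p.+1)%N.
apply: lt_le_trans (lerXn2r r _ _ le_edges); rewrite ?nnegrE ?mulr_ge0 ?powR_ge0 //.
have r_neq0 : p.+1%:R != 0 :> R by rewrite pnatr_eq0.
(* The power [r = p.+1 ^ 2] clears the fraction: [r * (2 - 1 / p.+1) = 2 * (p.+1 * p) + p.+1]. *)
have -> : (E.+1%:R * #|V|%:R `^ (2 - p.+1%:R^-1)) ^+ r
    = E.+1%:R ^+ r * #|V|%:R ^+ (2 * (p.+1 * p) + p.+1) :> R.
  rewrite exprMn; congr (_ * _).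
  rewrite -[LHS]powR_mulrn ?powR_ge0 // -powRrM -[RHS]powR_mulrn //.
  congr (_ `^ _); rewrite /r !natrD !natrM -natr1; field.
  by rewrite nat1r.
rewrite natrM natrX ltr_pM2r ?exprn_gt0 ?ltr0n // -natrX ltr_nat -/E.
by rewrite -[E.+1 in leqLHS]expn1 leq_pexp2l.
Qed.
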